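(* Let $T$ be a weakly irreducible nonnegative tensor of order $m$ and dimension $n$, let $E$ be the identity tensor, and let $\lambda_*$ be the eigenvalue of the unique positive eigenpair $(\lambda_*,x^* )$ of $T$ with $\sum_{i=1}^n x^*_i=1$. Let $x^{(0)}\in\mathbb{R}^n_{++}$ and let $\{x^{(k)}\}$ be the sequence generated by the higher order power method applied to $T+E$ (i.e. with $T$ replaced by $T+E$). Then $\{x^{(k)}\}$ converges to the unique vector $x^*\in\mathbb{R}^n_{++}$ satisfying $T(x^* )^{m-1}=\lambda_*(x^* )^{[m-1]}$ and $\sum_{i=1}^n x_i^*=1$, and there exist a constant $\theta\in(0,1)$ and a positive integer $M$ such that $$d(x^{(k)},x^* )\le \theta^{\frac{k}{M}}\,\frac{d(x^{(0)},x^* )}{\theta}$$ holds for all $k\ge 1$, where $d$ is Hilbert's projective metric.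
   Context: Throughout $m,n\ge 2$. A tensor $T$ of order $m$ and dimension $n$ is a real array $(T_{i_1\ldots i_m})$, $i_1,\dots,i_m\in\{1,\ldots,n\}$; nonnegative means all entries are nonnegative. $(Tx^{m-1})_i=\sum_{i_2,\ldots,i_m=1}^n T_{ii_2\ldots i_m}x_{i_2}\cdots x_{i_m}$, and $x^{[p]}$ is the vector with $i$-th component $x_i^p$. $(\lambda,x)$ with $\lambda\in\mathbb{C}$, $x\in\mathbb{C}^n\setminus\{0\}$ is an eigenpair of $T$ if $Tx^{m-1}=\lambda x^{[m-1]}$; it is a positive eigenpair if $\lambda>0$ and $x\in\mathbb{R}^n_{++}$ (all components positive). A weakly irreducible nonnegative tensor has a positive eigenpair, whose eigenvector is unique up to a multiplicative constant. The identity tensor $E$ has diagonal elements ($i_1=\cdots=i_m$) equal to $1$ and all others $0$. The representation $G(T)$ is the $n\times n$ matrix whose $(i,j)$ entry is the sum of all $T_{ii_2\ldots i_m}$ over $(i_2,\ldots,i_m)$ with $j\in\{i_2,\ldots,i_m\}$; $T$ is weakly irreducible if $G(T)$ is an irreducible matrix. Higher order power method for a nonnegative tensor $S$: starting from $x^{(0)}\in\mathbb{R}^n_{++}$, for $k=0,1,2,\ldots$ set $\bar x^{(k+1)}=S(x^{(k)})^{m-1}$ and $x^{(k+1)}=\dfrac{(\bar x^{(k+1)})^{[1/(m-1)]}}{e^T(\bar x^{(k+1)})^{[1/(m-1)]}}$, with $e$ the all-ones vector. (In the algorithm the iteration is stopped if $\max_i (S(x^{(k)})^{m-1})_i/(x^{(k)}_i)^{m-1}=\min_i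 (S(x^{(k)})^{m-1})_i/(x^{(k)}_i)^{m-1}$, i.e. if $x^{(k)}$ is already an eigenvector; the convergence statement concerns the infinite sequence given by the recursion.) Hilbert's projective metric: $x,y\in\mathbb{R}^n_+\setminus\{0\}$ are comparable if $\alpha x\le y\le\beta x$ (componentwise) for some $\alpha,\beta>0$; then with $m(y/x)=\sup\{\alpha>0: \alpha x\le y\}$ and $M(y/x)=\inf\{\beta>0: y\le\beta x\}$, $d(x,y)=\log\frac{M(y/x)}{m(y/x)}$; if not comparable, $d(x,y)=+\infty$. *)

(* Defs.v *)
From HB Require Import structures.
From mathcomp Require Import all_boot all_order all_fingroup all_algebra.
From mathcomp Require Import all_classical all_reals all_analysis.
Set Implicit Arguments.
Unset Strict Implicit.
Unset Printing Implicit Defensive.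
Import Order.TTheory GRing.Theory Num.Theory.
Import numFieldNormedType.Exports.
Local Open Scope classical_set_scope.
Local Open Scope ring_scope.

Notation tensor K m n := {ffun m.-tuple 'I_n -> K}.

Definition identity_tensor (K : pzRingType) (m n : nat) : tensor K m n :=
  [ffun t : m.-tuple 'I_n => (constant t)%:R].

(* (T x^{m-1})_i: the tuples t = (i, i_2, ..., i_m) are those with head i, and
   behead t = (i_2, ..., i_m). *)
Definition tensor_app (K : comPzRingType) (m n : nat) (T : tensor K m n)
    (x : 'cV[K]_n) : 'cV[K]_n :=
  \col_i \sum_(t : m.-tuple 'I_n | ohead t == Some i)
    T t * \prod_(j <- behead t) x j 0.

Definition vec_pow (K : pzRingType) (n : nat) (x : 'cV[K]_n) (p : nat) :
  'cV[K]_n := \col_i (x i 0) ^+ p.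

(* Stated over any commutative ring; a positive eigenpair is real, so for it
   the equation may be read over the reals instead of the complex numbers. *)
Definition tensor_eigenpair (K : comPzRingType) (m n : nat)
    (T : tensor K m n) (lam : K) (x : 'cV[K]_n) : Prop :=
  x != 0 /\ tensor_app T x = lam *: vec_pow x m.-1.

Definition nonneg_tensor (R : numDomainType) (m n : nat) (T : tensor R m n) :
  Prop := forall t, 0 <= T t.

Definition pos_vec (R : numDomainType) (n : nat) (x : 'cV[R]_n) : Prop :=
  forall i, 0 < x i 0.

Definition positive_eigenpair (R : numDomainType) (m n : nat)
    (T : tensor R m n) (lam : R) (x : 'cV[R]_n) : Prop :=
  [/\ tensor_eigenpair T lam x, 0 < lam & pos_vec x].

(* Some simultaneous permutation of rows and columns brings A to the form
   [[B, C], [0, D]], with square diagonal blocks of sizes r and n - r. *)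
Definition reducible_mx (K : pzRingType) (n : nat) (A : 'M[K]_n) : Prop :=
  exists (s : 'S_n) (r : nat), (0 < r < n)%N /\
    forall i j : 'I_n, (r <= i)%N -> (j < r)%N ->
      (perm_mx s *m A *m (perm_mx s)^T) i j = 0.

Definition irreducible_mx (K : pzRingType) (n : nat) (A : 'M[K]_n) : Prop :=
  ~ reducible_mx A.

Definition tensor_graph_mx (K : nmodType) (m n : nat) (T : tensor K m n) :
    'M[K]_n :=
  \matrix_(i, j)
    \sum_(t : m.-tuple 'I_n | (ohead t == Some i) && (j \in behead t)) T t.

Definition weakly_irreducible (K : pzRingType) (m n : nat)
  (T : tensor K m n) : Prop := irreducible_mx (tensor_graph_mx T).

Definition hopm_step (R : realType) (m n : nat) (S : tensor R m n)
    (x : 'cV[R]_n) : 'cV[R]_n :=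
  let y : 'cV[R]_n :=
    map_mx (fun a : R => a `^ (m.-1%:R)^-1) (tensor_app S x) in
  (\sum_i y i 0)^-1 *: y.

Definition hopm (R : realType) (m n : nat) (S : tensor R m n)
  (x0 : 'cV[R]_n) (k : nat) : 'cV[R]_n := iter k (hopm_step S) x0.

Definition le_vec (R : numDomainType) (n : nat) (x y : 'cV[R]_n) : Prop :=
  forall i, x i 0 <= y i 0.

Definition hilbert_comparable (R : realType) (n : nat) (x y : 'cV[R]_n) :
    Prop :=
  exists a b : R, [/\ 0 < a, 0 < b, le_vec (a *: x) y & le_vec y (b *: x)].

(* m(y/x) and M(y/x), in this argument order. *)
Definition hilbert_m (R : realType) (n : nat) (y x : 'cV[R]_n) : R :=
  sup [set a : R | 0 < a /\ le_vec (a *: x) y].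

Definition hilbert_M (R : realType) (n : nat) (y x : 'cV[R]_n) : R :=
  inf [set b : R | 0 < b /\ le_vec y (b *: x)].

(* Meaningful for nonzero vectors with nonnegative entries. *)
Definition hilbert_metric (R : realType) (n : nat) (x y : 'cV[R]_n) : \bar R :=
  if `[< hilbert_comparable x y >]
  then (ln (hilbert_M y x / hilbert_m y x))%:E else +oo%E.

(* Main.v *)
Require Import Defs.
From HB Require Import structures.
From mathcomp Require Import all_boot all_order all_fingroup all_algebra.
From mathcomp Require Import all_classical all_reals all_analysis.
From mathcomp Require Import ring lra.
Set Implicit Arguments.
Unset Strict Implicit.
Unset Printing Implicit Defensive.
Import Order.TTheory GRing.Theory Num.Theory.
Import numFieldNormedType.Exports.
Local Open Scope classical_set_scope.
Local Open Scope ring_scope.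

(** Write S = T + E, p = m - 1 and mu = lam + 1, so that S xs^p = mu xs^[p].
    Measure a positive vector x by the ratios r_i = x_i / xs_i: the Hilbert
    distance d(x, xs) is ln (max r / min r).  Up to a positive factor, one step
    of the method replaces r_i ^ p by an average, with weights
    S_t prod xs_j / (mu xs_i^p), of the products of p of the ratios r_j.
    Hence r never leaves an interval [a, b] that contains it, except for the
    common factor.

    The strict contraction comes from following the index where r = a.  If
    r_j <= b (1 - d) and j occurs in a tuple t with head i and S t > 0, then
    the average at i is at most b^p (1 - c d), where c bounds the positive
    weights from below.  Bernoulli's inequality turns this into
    r_i <= b (1 - (c / p) d) after the step (hopm_step_gap).  The diagonal
    entries brought by E keep the gap at indices that already have one, and
    weak irreducibility extends it to at least one further index at each
    step, so after n steps it is everywhere (hopm_gap_spreads).  With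
    K = (c / p)^n and rho = max r / min r, n steps give
    rho <- rho - K (rho - 1) (within_contract).

    In terms of u = ln rho this is only a nonlinear contraction, whose rate
    tends to 1 as u grows; but since distances never increase, u stays below
    its initial value u0, and there the map is a contraction of ratio
    theta = 1 - K exp (- u0) / 2 (hopm_within_decay).  So theta depends on the
    starting point and M = n.  Convergence follows because all iterates
    after the first have sum 1, like xs (hopm_cvg); uniqueness of xs follows
    because a positive eigenvector for lam of sum 1 is a fixed point of the
    method. *)

(** * Irreducibility and elementary inequalities *)

(** Listing the indices of V before the others gives the permutation that
    exhibits the zero block. *)
Lemma reducible_mx_closed (K : pzRingType) (n : nat) (A : 'M[K]_n)
    (V : {set 'I_n}) :
  (0 < #|V| < n)%N ->
  (forall i j, i \notin V -> j \in V -> A i j = 0) -> reducible_mx A.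
Proof.
move=> cardV Avanish.
pose s := enum V ++ enum (~: V).
have ss : size s = n by rewrite size_cat -!cardE cardsC card_ord.
have us : uniq s.
  rewrite cat_uniq !enum_uniq andbT; apply/hasPn => i.
  by rewrite !mem_enum inE.
pose f (k : 'I_n) := nth k s k.
have f_inj : injective f.
  move=> k l; rewrite /f (set_nth_default k) ?ss// => /eqP.
  by rewrite nth_uniq ?ss// => /eqP/val_inj.
exists (perm f_inj), #|V|; split=> // i j Vi Vj.
rewrite tr_perm_mx -row_permE -col_permE !mxE !permE; apply: Avanish.
  rewrite /f nth_cat -cardE ltnNge Vi /=.
  rewrite -finset.in_setC -mem_enum mem_nth// -(ltn_add2r #|V|) subnK// addnC -cardE.
  by rewrite cardsC card_ord.
by rewrite /f nth_cat -cardE Vj -mem_enum mem_nth// -cardE.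
Qed.

Lemma weakly_irreducible_edge (R : realDomainType) (m n : nat)
    (T : tensor R m n) (V : {set 'I_n}) :
  nonneg_tensor T -> weakly_irreducible T -> (0 < #|V| < n)%N ->
  exists i j (t : m.-tuple _), [/\ i \notin V, j \in V, ohead t = Some i,
    j \in behead t & 0 < T t].
Proof.
move=> T0 Tirr cardV; apply: contrapT => noedge; apply: Tirr.
apply: (reducible_mx_closed cardV) => i j iV jV.
rewrite mxE big1// => t /andP[/eqP ti tj].
apply/eqP; rewrite eq_le T0 andbT leNgt; apply/negP => Tt.
by apply: noedge; exists i, j, t.
Qed.

Lemma bernoulli_ineq (R : realDomainType) (p : nat) (u : R) :
  0 <= u <= 1 -> 1 - u *+ p <= (1 - u) ^+ p.
Proof.
move=> /andP[u0 u1]; elim: p => [|p IH]; first by rewrite mulr0n subr0.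
rewrite exprSr (le_trans _ (ler_wpM2r _ IH)) ?subr_ge0//.
rewrite mulrSr mulrBr mulr1 mulrBl mul1r opprB opprD addrA.
by rewrite lerD2l lerBDr addrC subrr mulr_ge0 ?mulrn_wge0.
Qed.

Lemma fin_pos_lower_bound (R : realDomainType) (I : finType) (f : I -> R) :
  exists2 c, 0 < c <= 1 & forall i, 0 < f i -> c <= f i.
Proof.
exists (\big[Num.min/1]_(i | 0 < f i) f i); last first.
  by move=> i fi; apply: bigmin_le_cond.
by rewrite bigmin_le_id lt_bigmin.
Qed.

Lemma ler_prod_gap (R : numDomainType) (I : eqType) (s : seq I)
    (x y : I -> R) (e : R) (j : I) :
  (forall i, 0 <= x i <= y i) -> j \in s -> x j <= e * y j ->
  \prod_(i <- s) x i <= e * \prod_(i <- s) y i.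
Proof.
move=> xy js xj; rewrite !(big_rem _ js)/= mulrA ler_pM ?ler_prod//.
- by have /andP[] := xy j.
- by apply: prodr_ge0 => i _; have /andP[] := xy i.
Qed.

(** * One step of the power method *)

Section PowerMethod.
Variables (R : realType) (m n : nat) (S : tensor R m n).
Hypotheses (hm : (2 <= m)%N) (hn : (0 < n)%N).
Hypothesis S_nonneg : nonneg_tensor S.
Hypothesis S_diag : forall i, 0 < S (nseq_tuple m i).

Lemma size_behead_tuple (t : m.-tuple 'I_n) : size (behead t) = m.-1.
Proof. by rewrite size_behead size_tuple. Qed.

Lemma ohead_nseq_tuple (i : 'I_n) : ohead (nseq_tuple m i) = Some i.
Proof. by case: m hm. Qed.

Lemma tensor_app_gt0 (x : 'cV[R]_n) :
  pos_vec x -> pos_vec (tensor_app S x).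
Proof.
move=> x0 i; rewrite mxE (bigD1 (nseq_tuple m i)) ?ohead_nseq_tuple//=.
apply: ltr_pwDl; first by rewrite mulr_gt0// prodr_gt0.
by apply: sumr_ge0 => t _; rewrite mulr_ge0// prodr_ge0// => j _; apply: ltW.
Qed.

(** The normalizing denominator of [hopm_step]. *)
Definition hopm_scale (x : 'cV[R]_n) : R :=
  \sum_i (tensor_app S x i 0) `^ (m.-1%:R)^-1.

Lemma hopm_stepE x i :
  hopm_step S x i 0 = (hopm_scale x)^-1 * (tensor_app S x i 0) `^ (m.-1%:R)^-1.
Proof.
by rewrite /hopm_step !mxE; congr (_^-1 * _); apply: eq_bigr => j _; rewrite !mxE.
Qed.

Lemma hopm_scale_gt0 x : pos_vec x -> 0 < hopm_scale x.
Proof.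
move=> x0; rewrite /hopm_scale (bigD1 (Ordinal hn))//= ltr_pwDl//.
  by rewrite powR_gt0// tensor_app_gt0.
by apply: sumr_ge0 => i _; apply: powR_ge0.
Qed.

Lemma hopm_step_gt0 x : pos_vec x -> pos_vec (hopm_step S x).
Proof.
move=> x0 i; rewrite hopm_stepE mulr_gt0 ?invr_gt0 ?hopm_scale_gt0//.
by rewrite powR_gt0// tensor_app_gt0.
Qed.

Lemma hopm_step_sum x : pos_vec x -> \sum_i hopm_step S x i 0 = 1.
Proof.
move=> x0; under eq_bigr do rewrite hopm_stepE.
by rewrite -mulr_sumr mulVf// gt_eqF ?hopm_scale_gt0.
Qed.

Lemma hopm_gt0 x k : pos_vec x -> pos_vec (hopm S x k).
Proof. by move=> x0; elim: k => //= k; apply: hopm_step_gt0. Qed.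

Lemma powR_root (z : R) : 0 <= z -> (z ^+ m.-1) `^ (m.-1%:R)^-1 = z.
Proof.
move=> z0; rewrite -powR_mulrn// -powRrM mulfV ?powRr1//.
by rewrite pnatr_eq0 -lt0n -ltnS prednK// ltnW.
Qed.

Variables (mu : R) (xs : 'cV[R]_n).
Hypotheses (mu0 : 0 < mu) (xs0 : pos_vec xs).
Hypothesis eigS : tensor_app S xs = mu *: vec_pow xs m.-1.

Lemma tensor_app_eigS i : \sum_(t : m.-tuple 'I_n | ohead t == Some i)
   S t * \prod_(j <- behead t) xs j 0 = mu * xs i 0 ^+ m.-1.
Proof. by move/matrixP/(_ i 0): eigS; rewrite !mxE. Qed.

Lemma prod_scaled_eig (t : m.-tuple 'I_n) (b : R) :
  \prod_(j <- behead t) (b * xs j 0) =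
  b ^+ m.-1 * \prod_(j <- behead t) xs j 0.
Proof. by rewrite big_split/= big_const_seq count_predT iter_mulr_1 size_behead_tuple. Qed.

(** The common factor of a step: [hopm_step S x] is [root_scale x] times the
    homogeneous map x |-> ((S x^p) / mu)^[1/p], which fixes [xs].  All bounds
    are taken modulo this factor, which the Hilbert metric ignores. *)
Definition root_scale x : R := (hopm_scale x)^-1 * mu `^ (m.-1%:R)^-1.

Lemma root_scale_gt0 x : pos_vec x -> 0 < root_scale x.
Proof.
by move=> x0; rewrite mulr_gt0 ?invr_gt0 ?hopm_scale_gt0// powR_gt0.
Qed.

Lemma hopm_step_le x i z : pos_vec x -> 0 <= z ->
  tensor_app S x i 0 <= mu * z ^+ m.-1 ->
  hopm_step S x i 0 <= root_scale x * z.
Proof.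
move=> x0 z0 Sx; rewrite hopm_stepE -mulrA ler_pM2l ?invr_gt0 ?hopm_scale_gt0//.
rewrite -(powR_root z0) -powRM ?exprn_ge0 ?(ltW mu0)//.
by rewrite ge0_ler_powR ?invr_ge0// nnegrE ?mulr_ge0 ?exprn_ge0// ltW// tensor_app_gt0.
Qed.

Lemma hopm_step_ge x i z : pos_vec x -> 0 <= z ->
  mu * z ^+ m.-1 <= tensor_app S x i 0 ->
  root_scale x * z <= hopm_step S x i 0.
Proof.
move=> x0 z0 Sx; rewrite hopm_stepE -mulrA ler_pM2l ?invr_gt0 ?hopm_scale_gt0//.
rewrite -(powR_root z0) -powRM ?exprn_ge0 ?(ltW mu0)//.
by rewrite ge0_ler_powR ?invr_ge0// nnegrE ?mulr_ge0 ?exprn_ge0// ltW// tensor_app_gt0.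
Qed.

Lemma hopm_step_lower x a : pos_vec x -> 0 <= a ->
  le_vec (a *: xs) x -> le_vec (root_scale x * a *: xs) (hopm_step S x).
Proof.
move=> x0 a0 ax i; rewrite [leLHS]mxE -mulrA hopm_step_ge ?mulr_ge0 ?(ltW (xs0 _))//.
rewrite exprMn mulrCA -tensor_app_eigS mulr_sumr mxE ler_sum// => t _.
rewrite mulrCA ler_wpM2l// -prod_scaled_eig ler_prod// => j _.
by have := ax j; rewrite mxE => ->; rewrite mulr_ge0// ltW.
Qed.

Lemma hopm_step_upper x b : pos_vec x -> 0 <= b ->
  le_vec x (b *: xs) -> le_vec (hopm_step S x) (root_scale x * b *: xs).
Proof.
move=> x0 b0 xb i; rewrite [leRHS]mxE -mulrA hopm_step_le ?mulr_ge0 ?(ltW (xs0 _))//.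
rewrite exprMn mulrCA -tensor_app_eigS mulr_sumr mxE ler_sum// => t _.
rewrite mulrCA ler_wpM2l// -prod_scaled_eig ler_prod// => j _.
by have := xb j; rewrite mxE => ->; rewrite ltW.
Qed.

(** Every positive weight S_t prod xs_j / (mu xs_i^p) is at least c. *)
Definition edge_weight_bound (c : R) : Prop :=
  forall (t : m.-tuple 'I_n) i, ohead t = Some i -> 0 < S t ->
    c * (mu * xs i 0 ^+ m.-1) <= S t * \prod_(j <- behead t) xs j 0.

Lemma edge_weight_bound_exists : exists2 c, 0 < c <= 1 & edge_weight_bound c.
Proof.
have [c c01 cP] := fin_pos_lower_bound (fun ti : m.-tuple 'I_n * 'I_n =>
  S ti.1 * \prod_(j <- behead ti.1) xs j 0 / (mu * xs ti.2 0 ^+ m.-1)).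
exists c => // t i ti St.
have d0 : 0 < mu * xs i 0 ^+ m.-1 by rewrite mulr_gt0// exprn_gt0.
rewrite -ler_pdivlMr//; apply: (cP (t, i)) => /=.
by rewrite divr_gt0// mulr_gt0// prodr_gt0.
Qed.

(** The term t alone lowers the upper bound b^p mu xs_i^p of (S x^p)_i by the
    fraction c d, because one of its factors is short by the fraction d.
    Taking p-th roots costs at most a factor p, by Bernoulli's inequality. *)
Lemma hopm_step_gap (c b d : R) x (t : m.-tuple 'I_n) i j :
  0 < c <= 1 -> edge_weight_bound c -> pos_vec x -> 0 <= b -> 0 <= d <= 1 ->
  le_vec x (b *: xs) -> ohead t = Some i -> j \in behead t -> 0 < S t ->
  x j 0 <= b * (1 - d) * xs j 0 ->
  hopm_step S x i 0 <= root_scale x * (b * (1 - c / m.-1%:R * d)) * xs i 0.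
Proof.
move=> /andP[c0 c1] cP x0 b0 /andP[d0 d1] xb ti jt St xj.
have p1 : 1 <= m.-1%:R :> R by rewrite ler1n -ltnS prednK// ltnW.
have p0 : 0 < m.-1%:R :> R by rewrite (lt_le_trans ltr01).
have k01 : 0 <= c / m.-1%:R * d <= 1.
  have k0 : 0 <= c / m.-1%:R by rewrite divr_ge0// ltW.
  rewrite mulr_ge0//= mulr_ile1//.
  by rewrite ler_pdivrMr// mul1r (le_trans c1).
have xbE l : 0 <= x l 0 <= b * xs l 0.
  by have := xb l; rewrite mxE => ->; rewrite ltW.
have k0 : 0 <= 1 - c / m.-1%:R * d by rewrite subr_ge0; case/andP: k01.
rewrite -mulrA hopm_step_le ?mulr_ge0 ?(ltW (xs0 _))//.
have gap : tensor_app S x i 0 <= b ^+ m.-1 *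
    (mu * xs i 0 ^+ m.-1 - d * (S t * \prod_(l <- behead t) xs l 0)).
  rewrite mulrBr -tensor_app_eigS mulr_sumr mxE.
  rewrite (bigD1 t) ?ti//= [in leRHS](bigD1 t) ?ti//= addrAC lerD//.
    rewrite [leRHS](_ : _ = S t * ((1 - d) * \prod_(l <- behead t) (b * xs l 0))).
      rewrite ler_wpM2l// (ler_prod_gap xbE jt)//.
      by rewrite mulrA [_ * b]mulrC.
    by rewrite prod_scaled_eig; ring.
  apply: ler_sum => t' _; rewrite mulrCA ler_wpM2l// -prod_scaled_eig ler_prod//.
apply: (le_trans gap); rewrite !exprMn.
have bern := bernoulli_ineq m.-1 k01.
rewrite -[(c / _ * d) *+ _]mulr_natr (_ : c / _ * d * _ = c * d) in bern; last first.
  by field; rewrite gt_eqF.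
rewrite [leRHS](_ : _ = b ^+ m.-1 * ((1 - c / m.-1%:R * d) ^+ m.-1 *
   (mu * xs i 0 ^+ m.-1))); last by ring.
rewrite ler_wpM2l ?exprn_ge0//.
have w0 : 0 <= mu * xs i 0 ^+ m.-1 by rewrite mulr_ge0 ?exprn_ge0// ltW.
apply: le_trans (ler_wpM2r w0 bern).
by rewrite mulrBl mul1r lerD2l lerN2 [c * d]mulrC -mulrA ler_wpM2l// cP.
Qed.

(** * Contraction over n steps *)

(** Weak irreducibility in the form in which it is used: every proper nonempty
    set of indices is entered by a positive entry whose head lies outside. *)
Hypothesis S_edge : forall V : {set 'I_n}, (0 < #|V| < n)%N ->
  exists i j (t : m.-tuple 'I_n), [/\ i \notin V, j \in V, ohead t = Some i,
    j \in behead t & 0 < S t].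

(** The set V of indices with a gap starts as {i0} and gains an element at each
    step until it is full; the diagonal of S prevents it from losing any. *)
Lemma hopm_gap_spreads (c a b d : R) x i0 k :
  0 < c <= 1 -> edge_weight_bound c -> pos_vec x ->
  0 <= a -> 0 <= b -> 0 <= d <= 1 ->
  le_vec (a *: xs) x -> le_vec x (b *: xs) ->
  x i0 0 <= b * (1 - d) * xs i0 0 ->
  exists s (V : {set 'I_n}),
    [/\ 0 < s, le_vec (s * a *: xs) (hopm S x k),
        le_vec (hopm S x k) (s * b *: xs), (minn n k.+1 <= #|V|)%N
      & forall i, i \in V ->
          hopm S x k i 0 <= s * b * (1 - (c / m.-1%:R) ^+ k * d) * xs i 0].
Proof.
move=> c01 cP x0 a0 b0 d01 ax xb xi0.
elim: k => [|k [s [V [s0 ay yb cV gV]]]].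
  exists 1, [set i0]%SET; rewrite !mul1r cards1 geq_minr.
  by split=> // i /set1P ->.
set y := hopm S x k in ay yb gV *.
have y0 : pos_vec y by apply: hopm_gt0.
have p1 : 1 <= m.-1%:R :> R by rewrite ler1n -ltnS prednK// ltnW.
have kap01 : 0 <= c / m.-1%:R <= 1.
  case/andP: c01 => c0 c1; rewrite divr_ge0 ?(ltW c0)//=.
  by rewrite ler_pdivrMr ?(lt_le_trans _ p1)// mul1r (le_trans c1).
have e01 : 0 <= (c / m.-1%:R) ^+ k * d <= 1.
  case/andP: kap01 => ? ?; case/andP: d01 => ? ?.
  by rewrite mulr_ge0 ?exprn_ge0//= mulr_ile1 ?exprn_ge0// exprn_ile1.
have gap i j (t : m.-tuple 'I_n) : ohead t = Some i -> j \in behead t ->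
    0 < S t -> j \in V -> hopm S x k.+1 i 0 <=
    root_scale y * s * b * (1 - (c / m.-1%:R) ^+ k.+1 * d) * xs i 0.
  move=> ti jt St jV; rewrite exprS -[_ * _ * d]mulrA.
  have sb0 : 0 <= s * b by rewrite mulr_ge0// ltW.
  have := hopm_step_gap c01 cP y0 sb0 e01 yb ti jt St (gV j jV).
  by rewrite !mulrA.
have self (i : 'I_n) : i \in behead (nseq_tuple m i).
  by rewrite /=; case: m hm => [|[|m']]//= _; rewrite inE eqxx.
have gV' i : i \in V -> hopm S x k.+1 i 0 <=
    root_scale y * s * b * (1 - (c / m.-1%:R) ^+ k.+1 * d) * xs i 0.
  exact: (gap i i (nseq_tuple m i) (ohead_nseq_tuple i) (self i) (S_diag i)).
have lo : le_vec (root_scale y * s * a *: xs) (hopm S x k.+1).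
  by rewrite -[_ * s * a]mulrA; apply: hopm_step_lower; rewrite // mulr_ge0// ltW.
have up : le_vec (hopm S x k.+1) (root_scale y * s * b *: xs).
  by rewrite -[_ * s * b]mulrA; apply: hopm_step_upper; rewrite // mulr_ge0// ltW.
have s'0 : 0 < root_scale y * s by rewrite mulr_gt0// root_scale_gt0.
have V0 : (0 < #|V|)%N by apply: leq_trans cV; rewrite leq_min hn.
have [Vn|nV] := ltnP #|V| n; last first.
  by exists (root_scale y * s), V; split=> //; rewrite geq_min nV.
have [|i [j [t [iV jV ti jt St]]]] := S_edge (V := V); first by rewrite V0.
exists (root_scale y * s), (i |: V)%SET; split=> //; last first.
  by move=> l /setU1P[->|/gV'//]; apply: gap ti jt St jV.
rewrite cardsU1 iV add1n.
have kV : (k < #|V|)%N.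
  by move: cV; rewrite geq_min leqNgt Vn.
by rewrite geq_min ltnS kV orbT.
Qed.

(** For rho = exp u this says that the Hilbert distance of x to [xs] is at most
    u, without the suprema and infima of its definition. *)
Definition within (rho : R) (x : 'cV[R]_n) : Prop :=
  exists a, [/\ 0 < a, le_vec (a *: xs) x & le_vec x (a * rho *: xs)].

Lemma within_ge1 rho x : within rho x -> 1 <= rho.
Proof.
move=> [a [a0 ax xb]]; have := le_trans (ax (Ordinal hn)) (xb (Ordinal hn)).
by rewrite !mxE ler_pM2r// ler_pMr.
Qed.

Lemma within_le rho rho' x : rho <= rho' -> within rho x -> within rho' x.
Proof.
move=> rr [a [a0 ax xb]]; exists a; split=> // i.
by rewrite (le_trans (xb i))// !mxE ler_pM2r// ler_pM2l.
Qed.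

Lemma within_step rho x :
  pos_vec x -> within rho x -> within rho (hopm_step S x).
Proof.
move=> x0 wx; have rho1 := within_ge1 wx; case: wx => a [a0 ax xb].
exists (root_scale x * a); split; first by rewrite mulr_gt0// root_scale_gt0.
  by apply: hopm_step_lower => //; rewrite ltW.
rewrite -mulrA; apply: hopm_step_upper => //.
by rewrite mulr_ge0 ?(le_trans ler01 rho1) ?(ltW a0).
Qed.

Lemma hopm_within rho x k : pos_vec x -> within rho x -> within rho (hopm S x k).
Proof.
move=> x0 wx; elim: k => //= k wk; apply: within_step => //.
exact: hopm_gt0.
Qed.

(** The lower bound a may be replaced by min x_i / xs_i, which is attained at
    some i0; there the gap below the upper bound b is d = 1 - min / b.  After
    n steps the gap (c / p)^n d holds at every index and lowers the upper
    bound, while the lower bound has not moved. *)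
Lemma within_contract : exists2 K, 0 < K <= 1 & forall rho x,
  pos_vec x -> within rho x -> within (rho - K * (rho - 1)) (hopm S x n).
Proof.
have [c c01 cP] := edge_weight_bound_exists.
have p1 : 1 <= m.-1%:R :> R by rewrite ler1n -ltnS prednK// ltnW.
have p0 : 0 < m.-1%:R :> R by rewrite (lt_le_trans ltr01).
have /andP[kap0 kap1] : 0 < c / m.-1%:R <= 1.
  case/andP: c01 => c0 c1; rewrite divr_gt0//=.
  by rewrite ler_pdivrMr// mul1r (le_trans c1).
exists ((c / m.-1%:R) ^+ n); first by rewrite exprn_gt0// exprn_ile1// ltW.
set K := _ ^+ n => rho x x0 wx; have rho1 := within_ge1 wx.
have K0 : 0 < K by rewrite exprn_gt0.
have K1 : K <= 1 by rewrite exprn_ile1// ltW.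
have [a [a0 ax xb]] := wx.
pose r i := x i 0 / xs i 0.
have [i0 _ r_min] := @arg_minP _ _ _ (Ordinal hn) xpredT r isT.
have xi0 : x i0 0 = r i0 * xs i0 0 by rewrite /r divfK// gt_eqF.
have a'x : le_vec (r i0 *: xs) x.
  by move=> i; rewrite mxE -ler_pdivlMr// r_min.
have aa' : a <= r i0 by rewrite ler_pdivlMr//; have := ax i0; rewrite mxE.
set b := a * rho.
have b0 : 0 < b by rewrite mulr_gt0// (lt_le_trans ltr01).
have a'b : r i0 <= b by rewrite ler_pdivrMr//; have := xb i0; rewrite mxE.
have a'0 : 0 < r i0 by apply: lt_le_trans aa'.
have d01 : 0 <= 1 - r i0 / b <= 1.
  by rewrite subr_ge0 ler_pdivrMr// mul1r a'b gerBl divr_ge0// ltW.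
have xgap : x i0 0 <= b * (1 - (1 - r i0 / b)) * xs i0 0.
  by rewrite opprB addrC subrK mulrCA divff ?gt_eqF// mulr1 -xi0.
have [s [V [s0 lo _ cV gV]]] :=
  hopm_gap_spreads n c01 cP x0 (ltW a'0) (ltW b0) d01 a'x xb xgap.
exists (s * r i0); split; [exact: mulr_gt0| exact: lo |].
have VT i : i \in V.
  suff -> : V = [set: 'I_n]%SET by rewrite inE.
  apply/eqP; rewrite eqEcard finset.subsetT cardsT card_ord.
  by apply: leq_trans cV; rewrite leq_min leqnn leqnSn.
move=> i; apply: le_trans (gV i (VT i)) _; rewrite [leRHS]mxE ler_pM2r//.
rewrite -/K -[s * b * _]mulrA -[s * r i0 * _]mulrA ler_pM2l//.
rewrite (_ : b * _ = (1 - K) * b + K * r i0); last first.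
  by field; rewrite gt_eqF.
rewrite (_ : r i0 * _ = (1 - K) * (r i0 * rho) + K * r i0); last by ring.
by rewrite lerD2r ler_wpM2l ?subr_ge0// ler_pM2r// (lt_le_trans ltr01).
Qed.

(** On 0 <= u <= u0 one has 1 - exp (- u) >= u exp (- u0), hence
    exp (- u) (exp u - K (exp u - 1)) = 1 - K (1 - exp (- u))
    <= exp (- K exp (- u0) u), a linear contraction of u. The factor 1/2
    in the rate keeps it positive even if K = 1 and u0 = 0. *)
Lemma hopm_within_decay x u0 : pos_vec x -> 0 <= u0 -> within (expR u0) x ->
  exists2 theta, 0 < theta < 1 & forall k,
    within (expR (theta ^+ (k %/ n) * u0)) (hopm S x k).
Proof.
move=> x0 u00 wx; have [K /andP[K0 K1] contr] := within_contract.
pose eta := K * expR (- u0) / 2.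
have eta01 : 0 < eta < 1.
  have e0 := expR_gt0 (- u0).
  rewrite divr_gt0 ?mulr_gt0//= ltr_pdivrMr// mul1r.
  have e1 : expR (- u0) <= 1 by rewrite -expR0 ler_expR oppr_le0.
  by rewrite (le_lt_trans (mulr_ile1 (ltW K0) (ltW e0) K1 e1))// ltr1n.
have /andP[eta0 eta1] := eta01.
have [theta0 theta1] : 0 < 1 - eta /\ 1 - eta < 1.
  by rewrite subr_gt0 ltrBlDr ltrDl.
have exp_contr u y : 0 <= u <= u0 -> pos_vec y -> within (expR u) y ->
    within (expR ((1 - eta) * u)) (hopm S y n).
  move=> /andP[u_ge0 uu0] y0 wy; apply: within_le (contr _ _ y0 wy).
  rewrite mulrBl mul1r expRD.
  rewrite (_ : _ - _ = expR u * (1 - K * (1 - expR (- u)))); last first.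
    have ee : expR u * expR (- u) = 1 by rewrite -expRD subrr expR0.
    by rewrite -[X in _ - K * (_ - X)]ee; ring.
  rewrite ler_pM2l ?expR_gt0//; apply: le_trans (expR_ge1Dx _).
  rewrite lerD2l lerN2.
  have step1 : u * expR (- u) <= 1 - expR (- u).
    have := ler_wpM2r (expR_ge0 (- u)) (expR_ge1Dx u).
    by rewrite -expRD subrr expR0 mulrDl mul1r lerBrDl.
  have step2 : u * expR (- u0) <= u * expR (- u).
    by rewrite ler_wpM2l// ler_expR lerN2.
  have step3 : eta * u <= K * (u * expR (- u0)).
    have w0 : 0 <= K * (u * expR (- u0)).
      by rewrite mulr_ge0 ?(ltW K0)// mulr_ge0// expR_ge0.
    by rewrite /eta (_ : _ * u = K * (u * expR (- u0)) / 2); [lra|ring].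
  apply: le_trans step3 _; rewrite ler_pM2l//.
  exact: le_trans step2 step1.
exists (1 - eta) => [|k]; first by rewrite theta0.
(* The rate theta is the same for all blocks of n steps, since the distances
   never exceed u0. *)
have blocks q : within (expR ((1 - eta) ^+ q * u0)) (hopm S x (q * n)).
  elim: q => [|q IH]; first by rewrite expr0 mul1r mul0n.
  rewrite exprS -mulrA mulSn /hopm iterD; apply: exp_contr IH.
    by rewrite mulr_ge0 ?exprn_ge0 ?(ltW theta0)//= ler_piMl// exprn_ile1// ltW.
  exact: hopm_gt0.
(* The last k %% n steps do not increase the distance. *)
rewrite {2}(divn_eq k n) addnC /hopm iterD.
by apply: hopm_within => //; apply: hopm_gt0.
Qed.

(** * Comparison with the Hilbert metric *)

Lemma within_exists x : pos_vec x -> exists rho, within rho x.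
Proof.
move=> x0.
have [a /andP[a0 _] aP] := fin_pos_lower_bound (fun i => x i 0 / xs i 0).
have [b /andP[b0 _] bP] := fin_pos_lower_bound (fun i => xs i 0 / x i 0).
exists (a^-1 * b^-1), a; split=> // i; rewrite !mxE.
  by rewrite -ler_pdivlMr// aP// divr_gt0.
rewrite mulVKf ?gt_eqF// ler_pdivlMl// -ler_pdivlMr//.
by rewrite bP// divr_gt0.
Qed.

Lemma hilbert_M_bounds x a : pos_vec x -> 0 < a ->
  le_vec (a *: xs) x -> le_vec xs (hilbert_M xs x *: x) /\ hilbert_M xs x <= a^-1.
Proof.
move=> x0 a0 ax.
have ainS : [set b : R | 0 < b /\ le_vec xs (b *: x)] a^-1.
  split; rewrite ?invr_gt0// => i; rewrite mxE ler_pdivlMl//.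
  by have := ax i; rewrite mxE.
split=> [i|].
  rewrite mxE -ler_pdivrMr//; apply: lb_le_inf; first by exists a^-1.
  by move=> b [_ /(_ i)]; rewrite mxE -ler_pdivrMr.
by apply: ge_inf => //; exists 0 => b [/ltW].
Qed.

Lemma hilbert_m_bounds x b : pos_vec x -> 0 < b ->
  le_vec x (b *: xs) -> le_vec (hilbert_m xs x *: x) xs /\ b^-1 <= hilbert_m xs x.
Proof.
move=> x0 b0 xb.
have binS : [set a : R | 0 < a /\ le_vec (a *: x) xs] b^-1.
  split; rewrite ?invr_gt0// => i; rewrite mxE ler_pdivrMl//.
  by have := xb i; rewrite mxE.
have ubS i : ubound [set a : R | 0 < a /\ le_vec (a *: x) xs] (xs i 0 / x i 0).
  by move=> a [_ /(_ i)]; rewrite mxE -ler_pdivlMr.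
split=> [i|].
  by rewrite mxE -ler_pdivlMr//; apply: ge_sup (ubS i); exists b^-1.
by apply: ub_le_sup => //; exists (xs (Ordinal hn) 0 / x (Ordinal hn) 0).
Qed.

(** The infimum and supremum that define the metric are attained, so its value
    u is the least one with [within (expR u) x]. *)
Lemma hilbert_metric_within x : pos_vec x ->
  exists u, [/\ 0 <= u, hilbert_metric x xs = u%:E, within (expR u) x
    & forall v, within (expR v) x -> u <= v].
Proof.
move=> x0; have [rho wx] := within_exists x0.
have rho0 := lt_le_trans ltr01 (within_ge1 wx).
have [a [a0 ax xb]] := wx.
have b0 : 0 < a * rho by rewrite mulr_gt0.
have [xM M_le] := hilbert_M_bounds x0 a0 ax.
have [mx m_ge] := hilbert_m_bounds x0 b0 xb.
set M := hilbert_M xs x in xM M_le; set l := hilbert_m xs x in mx m_ge.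
have l0 : 0 < l by rewrite (lt_le_trans _ m_ge)// invr_gt0.
have M0 : 0 < M.
  have := lt_le_trans (xs0 (Ordinal hn)) (xM (Ordinal hn)).
  by rewrite mxE pmulr_lgt0.
have wMl : within (M / l) x.
  exists M^-1; rewrite invr_gt0; split=> // i; rewrite mxE.
    by rewrite ler_pdivrMl//; have := xM i; rewrite mxE.
  rewrite mulKf ?gt_eqF// ler_pdivlMl//.
  by have := mx i; rewrite mxE.
exists (ln (M / l)); rewrite lnK ?posrE ?divr_gt0//; split=> //.
- by rewrite ln_ge0// (within_ge1 wMl).
- rewrite /hilbert_metric ifT//; apply/asboolP; exists l, M; split=> //.
move=> v [a' [a'0 a'x xb']].
have b'0 : 0 < a' * expR v by rewrite mulr_gt0// expR_gt0.
have [_ M_le'] := hilbert_M_bounds x0 a'0 a'x.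
have [_ m_ge'] := hilbert_m_bounds x0 b'0 xb'.
rewrite -ler_expR lnK ?posrE ?divr_gt0// ler_pdivrMr//.
apply: le_trans M_le' _; apply: le_trans (ler_wpM2l (expR_ge0 v) m_ge').
by rewrite invfM mulrCA divff ?mulr1// gt_eqF// expR_gt0.
Qed.

(** * Convergence *)

Hypothesis xs_sum : \sum_i xs i 0 = 1.

(** Summing the bounds a xs <= x <= a rho xs gives a <= 1 <= a rho when both
    vectors have sum 1. *)
Lemma within_dist rho (x : 'cV[R]_n) i : \sum_i x i 0 = 1 -> within rho x ->
  `|xs i 0 - x i 0| <= rho - 1.
Proof.
move=> x_sum wx; have rho1 := within_ge1 wx; case: wx => a [a0 ax xb].
have xs1 : xs i 0 <= 1.
  rewrite -xs_sum (bigD1 i)//= lerDl sumr_ge0// => j _; exact: ltW.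
have a1 : a <= 1.
  rewrite -x_sum -[a]mulr1 -xs_sum mulr_sumr ler_sum// => j _.
  by have := ax j; rewrite mxE.
have b1 : 1 <= a * rho.
  rewrite -x_sum -[a * rho]mulr1 -xs_sum mulr_sumr ler_sum// => j _.
  by have := xb j; rewrite mxE.
have := ax i; have := xb i; rewrite !mxE ler_norml => xbi axi.
have := xs0 i; set z := xs i 0 in xs1 xbi axi * => z0.
nra.
Qed.

Lemma hopm_cvg x : pos_vec x -> hopm S x @ \oo --> xs.
Proof.
move=> x0; have [u [u0 _ wx _]] := hilbert_metric_within x0.
have [theta /andP[th0 th1] wk] := hopm_within_decay x0 u0 wx.
apply/cvg_ballP => e e0.
have cvg1 : (fun q => expR (theta ^+ q * u)) @ \oo --> (1 : R).
  rewrite -(expR0 R); apply: continuous_cvg; first exact: continuous_expR.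
  rewrite -(mul0r u); apply: cvgMl; apply: cvg_expr.
  by rewrite ger0_norm// ltW.
have [q _ qP] : \forall q \near \oo, `|1 - expR (theta ^+ q * u)| < e.
  by move/cvgr_dist_lt: cvg1 => /(_ e e0).
exists (q * n).+1 => // -[//|k] /= qk; split=> // i j.
rewrite ord1 /ball/=.
apply: le_lt_trans (within_dist i _ (wk k.+1)) _.
  by apply: hopm_step_sum; apply: hopm_gt0.
have := qP q (leqnn q); apply: le_lt_trans; rewrite distrC.
apply: le_trans (ler_norm _); rewrite lerD2r ler_expR ler_wpM2r//.
apply: ler_wiXn2l; rewrite ?ltW//.
by rewrite leq_divRL// (leq_trans _ qk).
Qed.

End PowerMethod.

(** * Shift by the identity tensor *)

Lemma tensor_appDl (K : comPzRingType) (m n : nat) (T U : tensor K m n)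
    (x : 'cV[K]_n) : tensor_app (T + U) x = tensor_app T x + tensor_app U x.
Proof.
apply/matrixP => i j; rewrite !mxE -big_split; apply: eq_bigr => t _.
by rewrite ffunE mulrDl.
Qed.

Lemma tensor_app_identity (K : comPzRingType) (m n : nat) (x : 'cV[K]_n) :
  (0 < m)%N -> tensor_app (identity_tensor K m n) x = vec_pow x m.-1.
Proof.
move=> m0; apply/matrixP => i j; rewrite !mxE.
have ti : ohead (nseq_tuple m i) = Some i by case: m m0.
have bi : behead (nseq_tuple m i) = nseq m.-1 i by case: m m0 {ti}.
rewrite (bigD1 (nseq_tuple m i)) ?ti//= bi [X in _ + X]big1.
  rewrite ffunE constant_nseq mul1r addr0.
  by rewrite big_nseq iter_mulr_1.
move=> t /andP[/eqP hi tn].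
rewrite ffunE (_ : constant t = false) ?mul0r//; apply: contra_neqF tn.
case/(constantP i) => z tz; apply: val_inj => /=.
move: hi; rewrite tz size_tuple.
by case: m m0 {t tz ti bi} => // m _ [->].
Qed.

(** * The convergence theorem *)

Theorem theorem4p2 (R : realType) (m n : nat) (hm : (2 <= m)%N)
    (hn : (2 <= n)%N) (T : tensor R m n) (T_nonneg : nonneg_tensor T)
    (T_wirr : weakly_irreducible T) (lam : R) (xs : 'cV[R]_n)
    (eig : positive_eigenpair T lam xs) (xs_sum : \sum_i xs i 0 = 1)
    (x0 : 'cV[R]_n) (x0_pos : pos_vec x0) :
  let x : nat -> 'cV[R]_n := hopm (T + identity_tensor R m n) x0 in
  [/\ unique (fun y : 'cV[R]_n =>
        [/\ pos_vec y, tensor_app T y = lam *: vec_pow y m.-1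
          & \sum_i y i 0 = 1]) xs,
      x @ \oo --> xs
    & exists (theta : R) (M : nat),
        [/\ 0 < theta < 1, (0 < M)%N
          & forall k : nat, (1 <= k)%N ->
            (hilbert_metric (x k) xs
               <= (theta `^ (k%:R / M%:R))%:E
                  * (hilbert_metric x0 xs * (theta^-1)%:E))%E]].
Proof.
set S := T + identity_tensor R m n => x.
have [[_ eigT] lam0 xs0] := eig.
have n0 : (0 < n)%N := ltnW hn.
have TS t : T t <= S t by rewrite [S t]ffunE lerDl ffunE ler0n.
have S_nonneg : nonneg_tensor S by move=> t; apply: le_trans (TS t).
have S_diag i : 0 < S (nseq_tuple m i).
  by rewrite [S _]ffunE ltr_wpDl// ffunE constant_nseq.
have S_edge (V : {set 'I_n}) (hV : (0 < #|V| < n)%N) :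
    exists i j (t : m.-tuple 'I_n), [/\ i \notin V, j \in V,
      ohead t = Some i, j \in behead t & 0 < S t].
  have [i [j [t [iV jV ti jt Tt]]]] := weakly_irreducible_edge T_nonneg T_wirr hV.
  by exists i, j, t; split=> //; apply: lt_le_trans (TS t).
have eigSP y : tensor_app T y = lam *: vec_pow y m.-1 ->
    tensor_app S y = (lam + 1) *: vec_pow y m.-1.
  by move=> eigy; rewrite tensor_appDl tensor_app_identity ?(ltnW hm)// eigy scalerDl scale1r.
have eigS := eigSP _ eigT.
have mu0 : 0 < lam + 1 by rewrite ltr_wpDr.
have cvgS y : pos_vec y -> hopm S y @ \oo --> xs.
  exact: (hopm_cvg hm n0 S_nonneg S_diag mu0 xs0 eigS S_edge xs_sum).
split; last 2 first.
- exact: cvgS.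
- have [u [u0 dx0 wx0 _]] := hilbert_metric_within n0 xs0 x0_pos.
  have [theta th01 wk] :=
    hopm_within_decay hm n0 S_nonneg S_diag mu0 xs0 eigS S_edge x0_pos u0 wx0.
  have /andP[th0 th1] := th01.
  exists theta, n; split=> // k _.
  have xk0 : pos_vec (x k) by apply: hopm_gt0.
  have [v [_ -> _ v_le]] := hilbert_metric_within n0 xs0 xk0.
  rewrite dx0 -!EFinM lee_fin; apply: le_trans (v_le _ (wk k)) _.
  rewrite [leRHS]mulrCA [u * _]mulrC ler_wpM2r//.
  rewrite -powR_mulrn ?(ltW th0)// -[theta^-1]powR_inv1 ?(ltW th0)// -powRD ?(gt_eqF th0) ?implybT//.
  (* k %/ n > k / n - 1, and theta < 1: this is where 1 / theta is lost. *)
  apply: ger_powR; first by rewrite th0 ltW.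
  rewrite lerBlDr ler_pdivrMr ?ltr0n// natr1 -natrM ler_nat ltnW//.
  by rewrite ltn_ceil.
split=> // y [y0 eigy y_sum].
(* A second eigenvector y is fixed by the method, so its constant orbit
   converges to xs. *)
have step_y : hopm_step S y = y.
  apply/matrixP => i j; rewrite ord1.
  have yE k : (tensor_app S y k 0) `^ (m.-1%:R)^-1 = (lam + 1) `^ (m.-1%:R)^-1 * y k 0.
    rewrite (eigSP _ eigy) !mxE powRM ?exprn_ge0 ?(ltW mu0) ?(ltW (y0 _))//.
    by rewrite powR_root// ltW.
  rewrite hopm_stepE yE /hopm_scale; under eq_bigr do rewrite yE.
  by rewrite -mulr_sumr y_sum mulr1 mulKf// gt_eqF// powR_gt0.
have const_y k : hopm S y k = y by elim: k => //= k ->.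
apply/matrixP => i j; apply/eqP.
rewrite -subr_eq0 -normr_eq0 eq_le normr_ge0 andbT.
apply/ler_addgt0Pl => e e0; rewrite addr0 ltW//.
have /cvg_ballP/(_ e e0)[N _ /(_ N (leqnn N))] := cvgS y y0.
by rewrite /= const_y => -[_]; apply.
Qed.
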